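(* Let $c\in\mathbf R$, $c\ne0$. On $M=\mathbf R^{2n+1}$ with coordinates $(x,z,p)=(x_1,\dots,x_n,z,p_1,\dots,p_n)$ let $$\theta=dz-\sum_{i=1}^np_idx_i,\qquad \omega=c\,dx_1\wedge\cdots\wedge dx_n-dp_1\wedge\cdots\wedge dp_n,$$ $D=\{\theta=0\}$, and $$E_1=\Big\langle\frac{\partial}{\partial x_1}+p_1\frac{\partial}{\partial z},\dots,\frac{\partial}{\partial x_n}+p_n\frac{\partial}{\partial z}\Big\rangle,\qquad E_2=\Big\langle\frac{\partial}{\partial p_1},\dots,\frac{\partial}{\partial p_n}\Big\rangle .$$ Let $\pi_1:M\to W_1=\mathbf R^{n+1}$, $\pi_1(x,z,p)=(x,z)$, and $\pi_2:M\to W_2=\mathbf R^{n+1}$, $\pi_2(x,z,p)=(p,\sum_{i=1}^np_ix_i-z)$. Then the system $\mathcal M$ generated by $(\theta,d\theta,\omega)$ is a Monge--Ampère system with the Lagrangian pair $(E_1,E_2)$ on $M$. The projection to $W_1$ of a geometric solution of $\mathcal M$ satisfies the equation $\mathrm{Hess}(f)=c$ when it is represented as a graph $z=f(x_1,\dots,x_n)$, outside of its singular locus. The projection to $W_2$ of a geometric solution of $\mathcal M$ satisfies the equation $\mathrm{Hess}(f)=\frac1c$ when it is represented as a graph $z'=\sum_{i=1}^np_ix_i-z=f(p_1,\dots,p_n)$, outside of its singular locus.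
   Context: A Lagrangian pair on a contact manifold $(M^{2n+1},D=\{\theta=0\})$ is a pair $(E_1,E_2)$ of rank-$n$ subbundles of $D$, isotropic for $d\theta$, with $D=E_1\oplus E_2$. A (bi-decomposable) Monge--Ampère system with Lagrangian pair $(E_1,E_2)$ is an ideal $\langle\theta,d\theta,\omega\rangle$ of differential forms, where (locally) $\omega=\omega_1-\omega_2$ with $n$-forms such that $i_u\omega_1=0$ for $u\in E_2$, $i_v\omega_2=0$ for $v\in E_1$, $\omega_1|_{E_1}$ is a volume form on $E_1$ and $\omega_2|_{E_2}$ is a volume form on $E_2$. A geometric solution of $\mathcal M$ is an immersion $g:L\to M$ of an $n$-dimensional manifold $L$ with $g^*\theta=0$ and $g^*\omega=0$. The singular locus of its projection to $W_j$ is the set of points where $\pi_j\circ g$ is not an immersion. $\mathrm{Hess}(f)$ denotes the determinant of the matrix of second partial derivatives of the function $f$ of $n$ real variables. *)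

(* Defs.v *)
From HB Require Import structures.
From mathcomp Require Import all_boot all_order all_fingroup all_algebra.
From mathcomp Require Import all_classical all_reals all_analysis.

Set Implicit Arguments.
Unset Strict Implicit.
Unset Printing Implicit Defensive.

Import Order.TTheory GRing.Theory Num.Theory.
Import numFieldNormedType.Exports.

Local Open Scope classical_set_scope.
Local Open Scope ring_scope.

(* "Smooth" means C^oo throughout.  Points of R^N and
   tangent vectors of R^N are both row vectors 'rV[R]_N; a k-tuple of tangent
   vectors is the k x N matrix having them as rows. *)

Section Smoothness.
Context {R : realType} {V W : normedModType R}.

Fixpoint iter_derive (s : seq V) (f : V -> W) : V -> W :=
  if s is v :: s' then 'D_v (iter_derive s' f) else f.

(* Meant for open U: all iterated directional derivatives exist on U and are
   differentiable (hence continuous), i.e. f is C^oo on U. *)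
Definition smooth_on (U : set V) (f : V -> W) : Prop :=
  forall (s : seq V) (x : V), U x -> differentiable (iter_derive s f) x.

End Smoothness.

Section Forms.
Context {R : realType} {N : nat}.

(* Not necessarily alternating; see [diff_form]. *)
Definition form (k : nat) : Type := 'rV[R]_N -> 'M[R]_(k, N) -> R.

Definition multilinear_rows k (a : 'M[R]_(k, N) -> R) : Prop :=
  forall (A B C : 'M[R]_(k, N)) (i : 'I_k) (b c : R),
    row i A = b *: row i B + c *: row i C ->
    row' i B = row' i A -> row' i C = row' i A ->
    a A = b * a B + c * a C.

Definition alternating_rows k (a : 'M[R]_(k, N) -> R) : Prop :=
  forall (A : 'M[R]_(k, N)) (i j : 'I_k),
    i != j -> row i A = row j A -> a A = 0.

Definition diff_form (U : set 'rV[R]_N) k (w : form k) : Prop :=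
  [/\ forall x, U x -> multilinear_rows (w x),
      forall x, U x -> alternating_rows (w x)
    & forall v : 'M[R]_(k, N), smooth_on U (fun x => w x v)].

Definition wedge k l (a : form k) (b : form l) : form (k + l) :=
  fun x v => (k`! * l`!)%:R^-1 *
    \sum_(s : 'S_(k + l)) (-1) ^+ s *
      (a x (usubmx (row_perm s v)) * b x (dsubmx (row_perm s v))).

(* a_0 /\ ... /\ a_(k-1) *)
Fixpoint wedge_family k : ('I_k -> form 1) -> form k :=
  match k with
  | 0 => fun _ _ _ => 1
  | k'.+1 => fun a => wedge (a ord0) (wedge_family (fun i => a (lift ord0 i)))
  end.

(* The constant vector fields [row i v] commute, so that Cartan's formula for
   the exterior derivative has no bracket terms. *)
Definition ext_d k (w : form k) : form k.+1 :=
  fun x v => \sum_(i < k.+1)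
    (-1) ^+ i * 'D_(row i v) (fun y => w y (row' i v)) x.

(* The interior product of a 0-form is 0. *)
Definition interior k (u : 'rV[R]_N) (a : 'M[R]_(k, N) -> R) :
    'M[R]_(k.-1, N) -> R :=
  match k return ('M[R]_(k, N) -> R) -> 'M[R]_(k.-1, N) -> R with
  | 0 => fun _ _ => 0
  | k'.+1 => fun a v => a (col_mx u v)
  end a.

(* Homogeneous two-sided ideals of the algebra of smooth forms on R^N, given by
   their graded pieces. *)
Definition graded_ideal (I : forall k, set (form k)) : Prop :=
  [/\ forall k w, I k w -> diff_form setT w,
      forall k, I k (fun _ _ => 0),
      forall k a b, I k a -> I k b -> I k (fun x v => a x v + b x v),
      forall k l (a : form k) (b : form l),
        diff_form setT a -> I l b -> I (k + l)%N (wedge a b)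
    & forall k l (a : form k) (b : form l),
        I k a -> diff_form setT b -> I (k + l)%N (wedge a b)].

(* The ideal <theta, d theta, omega>. *)
Definition generated_ideal n (theta : form 1) (omega : form n) :
    forall k, set (form k) :=
  fun k w => forall I : (forall k, set (form k)),
    graded_ideal I -> I 1 theta -> I 2 (ext_d theta) -> I n omega -> I k w.

End Forms.
Arguments form : clear implicits.
Arguments generated_ideal {R N n} theta omega k _.

Definition pullback {R : realType} {m N k : nat} (h : 'rV[R]_m -> 'rV[R]_N)
    (w : form R N k) : form R m k :=
  fun t v => w (h t) (v *m 'J h t).

Section MongeAmpere.
Context {R : realType} {n : nat}.
Local Notation N := (n + 1 + n)%N.
Local Notation M := 'rV[R]_N.

Definition contact_distribution (theta : form R N 1) (x : M) : {vspace M} :=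
  lker (linfun (theta x : M -> R^o)).

Definition contact_form (theta : form R N 1) : Prop :=
  [/\ diff_form setT theta,
      forall x : M, exists u : M, theta x u != 0
    & forall (x : M) (u : M), u \in contact_distribution theta x ->
        (forall v : M, v \in contact_distribution theta x ->
           ext_d theta x (col_mx u v) = 0) ->
        u = 0].

Definition subbundle (r : nat) (E : M -> {vspace M}) : Prop :=
  forall x0 : M, exists U : set M, exists F : 'I_r -> M -> M,
    [/\ open U, U x0, forall i, smooth_on U (F i)
      & forall x, U x -> basis_of (E x) [tuple F i x | i < r]].

Definition isotropic (theta : form R N 1) (E : M -> {vspace M}) : Prop :=
  forall (x : M) (u v : M),
    u \in E x -> v \in E x -> ext_d theta x (col_mx u v) = 0.

Definition lagrangian_pair (theta : form R N 1) (E1 E2 : M -> {vspace M}) :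
    Prop :=
  [/\ contact_form theta,
      subbundle n E1 /\ subbundle n E2,
      isotropic theta E1 /\ isotropic theta E2
    & forall x : M, directv (E1 x + E2 x) /\
        contact_distribution theta x = (E1 x + E2 x)%VS].

(* For E x of dimension k: the restriction of the k-covector a to E x is
   nonzero. *)
Definition volume_on k (E : {vspace M}) (a : 'M[R]_(k, N) -> R) : Prop :=
  exists v : 'M[R]_(k, N), (forall i, row i v \in E) /\ a v != 0.

Definition bidecomposable (E1 E2 : M -> {vspace M}) (omega : form R N n) :
    Prop :=
  forall x0 : M, exists U : set M, exists omega1 omega2 : form R N n,
    [/\ open U /\ U x0,
        diff_form U omega1 /\ diff_form U omega2,
        forall x, U x -> omega x = (fun v => omega1 x v - omega2 x v),
        forall x, U x ->
          (forall u : M, u \in E2 x -> interior u (omega1 x) = fun _ => 0) /\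
          (forall u : M, u \in E1 x -> interior u (omega2 x) = fun _ => 0)
      & forall x, U x ->
          volume_on (E1 x) (omega1 x) /\ volume_on (E2 x) (omega2 x)].

Definition monge_ampere_system (theta : form R N 1) (E1 E2 : M -> {vspace M})
    (I : forall k, set (form R N k)) : Prop :=
  lagrangian_pair theta E1 E2 /\
  exists omega : form R N n,
    [/\ diff_form setT omega, bidecomposable E1 E2 omega
      & forall k, I k = generated_ideal theta omega k].

End MongeAmpere.

Section Manifolds.
Context {R : realType} {n : nat} {L : topologicalType}.

Record chart : Type := Chart {
  chart_dom : set L;
  chart_map : L -> 'rV[R]_n;
  chart_inv : 'rV[R]_n -> L }.

Definition chart_im (c : chart) : set 'rV[R]_n := chart_map c @` chart_dom c.

Definition is_chart (c : chart) : Prop :=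
  [/\ open (chart_dom c) /\ open (chart_im c),
      forall q, chart_dom c q -> chart_inv c (chart_map c q) = q,
      forall q, chart_dom c q -> {for q, continuous (chart_map c)}
    & forall t, chart_im c t -> {for t, continuous (chart_inv c)}].

Definition smooth_manifold (A : set chart) : Prop :=
  [/\ hausdorff_space L /\ @second_countable L,
      forall c, A c -> is_chart c,
      forall q : L, exists2 c, A c & chart_dom c q
    & forall c d, A c -> A d ->
        smooth_on (chart_map c @` (chart_dom c `&` chart_dom d))
                  (chart_map d \o chart_inv c)].

Definition smooth_map (A : set chart) m (h : L -> 'rV[R]_m) : Prop :=
  forall c, A c -> smooth_on (chart_im c) (h \o chart_inv c).

Definition immersive_at (A : set chart) m (h : L -> 'rV[R]_m) (q : L) : Prop :=
  forall c, A c -> chart_dom c q ->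
    injective ('d (h \o chart_inv c) (chart_map c q)).

Definition immersion (A : set chart) m (h : L -> 'rV[R]_m) : Prop :=
  smooth_map A h /\ forall q, immersive_at A h q.

Definition singular_locus (A : set chart) m (h : L -> 'rV[R]_m) : set L :=
  [set q | ~ immersive_at A h q].

(* h^* w = 0, read in the charts of L. *)
Definition pullback_vanishes (A : set chart) m k (h : L -> 'rV[R]_m)
    (w : form R m k) : Prop :=
  forall c, A c -> forall t, chart_im c t ->
    pullback (h \o chart_inv c) w t = fun _ => 0.

Definition geometric_solution (A : set chart) (theta : form R (n + 1 + n) 1)
    (omega : form R (n + 1 + n) n) (g : L -> 'rV[R]_(n + 1 + n)) : Prop :=
  [/\ immersion A g, pullback_vanishes A g theta & pullback_vanishes A g omega].

End Manifolds.
Arguments chart : clear implicits.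

Section Hessian.
Context {R : realType} {n : nat}.

Definition partial (i : 'I_n) (f : 'rV[R]_n -> R) : 'rV[R]_n -> R :=
  'D_(delta_mx 0 i) f.

Definition Hess (f : 'rV[R]_n -> R) (x : 'rV[R]_n) : R :=
  \det (\matrix_(i < n, j < n) partial i (partial j f) x).

Definition twice_differentiable_on (U : set 'rV[R]_n) (f : 'rV[R]_n -> R) :
    Prop :=
  forall x, U x ->
    differentiable f x /\ forall i, differentiable (partial i f) x.

(* The graph in R^(n+1) of the function f on U. *)
Definition graph_on (U : set 'rV[R]_n) (f : 'rV[R]_n -> R) :
    set 'rV[R]_(n + 1) :=
  [set row_mx x (f x)%:M | x in U].

(* The image of h satisfies Hess f = a wherever it is locally represented as a
   graph, outside of the singular locus.  Twice differentiability of f is what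
   gives Hess f its meaning: derivatives are total in the library. *)
Definition satisfies_Hess_eq (L : topologicalType) (A : set (chart R n L))
    (h : L -> 'rV[R]_(n + 1)) (a : R) : Prop :=
  forall (O : set L) (U : set 'rV[R]_n) (f : 'rV[R]_n -> R),
    open O -> open U -> twice_differentiable_on U f ->
    h @` O = graph_on U f ->
    forall q, O q -> ~ singular_locus A h q -> Hess f (lsubmx (h q)) = a.

End Hessian.

(* R^(2n+1) with coordinates (x, z, p). *)
Section Model.
Context {R : realType} {n : nat}.
Local Notation N := (n + 1 + n)%N.
Local Notation M := 'rV[R]_N.

Definition xcoord (w : M) : 'rV[R]_n := lsubmx (lsubmx w).
Definition zcoord (w : M) : R := rsubmx (lsubmx w) 0 0.
Definition pcoord (w : M) : 'rV[R]_n := rsubmx w.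

Definition dx (i : 'I_n) : form R N 1 := fun _ v => xcoord v 0 i.
Definition dz : form R N 1 := fun _ v => zcoord v.
Definition dp (i : 'I_n) : form R N 1 := fun _ v => pcoord v 0 i.

Definition del_x (i : 'I_n) : M := row_mx (row_mx (delta_mx 0 i) 0) 0.
Definition del_z : M := row_mx (row_mx 0 1%:M) 0.
Definition del_p (i : 'I_n) : M := row_mx 0 (delta_mx 0 i).

Definition theta : form R N 1 :=
  fun w v => dz w v - \sum_(i < n) pcoord w 0 i * dx i w v.

Definition omega (c : R) : form R N n :=
  fun w v => c * wedge_family dx w v - wedge_family dp w v.

Definition E1 (w : M) : {vspace M} :=
  <<[tuple (del_x i + pcoord w 0 i *: del_z)%R | i < n]>>%VS.
Definition E2 (w : M) : {vspace M} := <<[tuple del_p i | i < n]>>%VS.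

Definition pi1 (w : M) : 'rV[R]_(n + 1) := row_mx (xcoord w) (zcoord w)%:M.
Definition pi2 (w : M) : 'rV[R]_(n + 1) :=
  row_mx (pcoord w)
         (\sum_(i < n) pcoord w 0 i * xcoord w 0 i - zcoord w)%:M.

End Model.

(* Main.v *)
(* Along a solution let X, P, Z be the x-, p- and z-coordinates, so that
   dZ = P dX.  Where (X, Z) is an immersion this forces dX to be injective,
   hence invertible nearby; if Z = f(X), comparing dZ = P dX with
   dZ = (grad f)(X) dX gives P = (grad f)(X) near the point, hence
   dP = Hess(f) dX, and omega = 0 reads c det(dX) = det(dP).  The second
   projection is the same argument for the Legendre transform: W = P.X - Z
   satisfies dW = X dP. *)
From HB Require Import structures.
Require Import Defs.
From mathcomp Require Import all_boot all_order all_fingroup all_algebra.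
From mathcomp Require Import all_classical all_reals all_analysis.
Import Order.TTheory GRing.Theory Num.Theory.
Import numFieldNormedType.Exports.

Set Implicit Arguments.
Unset Strict Implicit.
Unset Printing Implicit Defensive.

Local Open Scope classical_set_scope.
Local Open Scope ring_scope.

(** * Wedge products of 1-forms as determinants *)

(** By induction on [k]. Expanding the inner determinant over [t] in the symmetric group on [k]
    letters writes the alternating sum as a double sum over [s] and [t]. For each fixed [t] the sum
    over [s] is the whole determinant, so it occurs [k!] times, which cancels the normalising factor
    of [wedge]. *)
Lemma wedge_family_det (R : realType) (N k : nat) (a : 'I_k -> Defs.form R N 1)
    (x : 'rV[R]_N) (v : 'M[R]_(k, N)) :
  wedge_family a x v = \det (\matrix_(i, j) a j x (row i v)).
Proof.
elim: k a v => [|k IH] a v; first by rewrite det_mx00.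
rewrite /= /wedge (_ : 1`! = 1%N) // mul1n.
pose T (s : 'S_k.+1) : R :=
  (-1) ^+ s * \prod_i a i x (row (s i) v).
have detE : \det (\matrix_(i, j) a j x (row i v)) = \sum_s T s.
  rewrite -det_tr; apply: eq_bigr => s _; congr (_ * _).
  by apply: eq_bigr => i _; rewrite !mxE.
(* A permutation [t] of the last [k] rows is absorbed into [s] by lifting it to fix [ord0]; the lift
   has the sign of [t]. *)
have expand (s : 'S_k.+1) :
    (-1) ^+ s * (a ord0 x (@usubmx _ 1 k N (row_perm s v)) *
      wedge_family (fun i => a (lift ord0 i)) x
        (@dsubmx _ 1 k N (row_perm s v))) =
    \sum_(t : 'S_k) T (lift_perm ord0 ord0 t * s)%g.
  rewrite IH -det_tr /determinant !mulr_sumr; apply: eq_bigr => t _.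
  rewrite /T odd_permM odd_lift_perm addbb addFb signr_addb.
  rewrite big_ord_recl permM lift_perm_id mulrCA !mulrA [_ * _ ^+ t]mulrC.
  rewrite -!mulrA; congr (_ * _); rewrite mulrCA; congr (_ * (_ * _)).
    congr (a _ _ _); apply/rowP => j; rewrite !mxE; congr (v (s _) j).
    exact: val_inj.
  apply: eq_bigr => i _; rewrite !mxE permM lift_perm_lift; congr (a _ _ _).
  by apply/rowP => j; rewrite !mxE; congr (v (s _) j); exact: val_inj.
rewrite detE (eq_bigr _ (fun s _ => expand s)) exchange_big /=.
under eq_bigr => t _.
  (* Left translation by the lifted [t] is a bijection of the symmetric group. *)
  rewrite (_ : \sum_s _ = \sum_s T s); last first.
    by rewrite [RHS](reindex_inj (mulgI (lift_perm ord0 ord0 t))).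
  over.
rewrite sumr_const card_Sn -[X in _ * X]mulr_natl mulKf //.
Qed.

(** * Derivatives of linear and affine maps on row vectors *)

Section LinearRowVectors.
Context {R : realType} {m : nat} {W : normedModType R}.
Implicit Types (L : {linear 'rV[R]_m -> W}) (v : 'rV[R]_m).

(** Finite dimension is what makes this true: [L] is a finite sum of coordinate functions times
    constant vectors. *)
Lemma linear_rV_differentiable L v : differentiable L v.
Proof.
have -> : (L : _ -> _) =
    \sum_(i < m) (fun u : 'rV[R]_m => (u 0 i : R) *: L (delta_mx 0 i)).
  apply/funext => u; rewrite fct_sumE {1}(row_sum_delta u) linear_sum.
  by apply: eq_bigr => i _; rewrite linearZ.
apply: differentiable_sum => i; apply: differentiableZl.
exact: differentiable_coord.
Qed.

Lemma diff_linear_rV L v : 'd L v = L :> (_ -> _).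
Proof.
apply: diff_lin => u; exact/differentiable_continuous/linear_rV_differentiable.
Qed.

Lemma differentiable_linear_comp (V : normedModType R) (h : V -> 'rV[R]_m) L x :
  differentiable h x -> differentiable (L \o h) x.
Proof.
by move=> dh; apply: differentiable_comp => //; exact: linear_rV_differentiable.
Qed.

Lemma derive_linear_comp (V : normedModType R) (h : V -> 'rV[R]_m) L x w :
  differentiable h x -> 'D_w (L \o h) x = L ('D_w h x).
Proof.
move=> dh; rewrite !deriveE //; last exact: differentiable_linear_comp.
by rewrite diff_comp //=; [rewrite diff_linear_rV | exact: linear_rV_differentiable].
Qed.

Lemma derive_affine (F : 'rV[R]_m -> W) (b : W) x v : linear F ->
  differentiable (fun x => b + F x) x /\ 'D_v (fun x => b + F x) x = F v.
Proof.
move=> linF; pose L : {linear 'rV[R]_m -> W} :=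
  HB.pack F (GRing.isLinear.Build R 'rV[R]_m W _ F linF).
have dL : differentiable L x by exact: linear_rV_differentiable.
have d : differentiable (fun x => b + F x) x.
  exact: (differentiableD (differentiable_cst b x) dL).
split=> //; rewrite (deriveE v d) (diffD (differentiable_cst b x) dL).
by rewrite diff_cst diff_linear_rV /= add0r.
Qed.

Lemma smooth_affine (U : set 'rV[R]_m) (F : 'rV[R]_m -> W) (b : W) :
  linear F -> smooth_on U (fun x => b + F x).
Proof.
(* The first derivative is the constant [F v], and every further one vanishes. *)
move=> linF; suff H (s : seq 'rV[R]_m) v :
    iter_derive (v :: s) (fun x => b + F x) = cst (if nilp s then F v else 0).
  case=> [|v s] x _; first by have [] := derive_affine b x 0 linF.
  by rewrite H.
elim: s v => [|w s IH] v; apply/funext => x.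
  by have [] := derive_affine b x v linF.
by rewrite /= -/(iter_derive (w :: s) _) IH derive_cst.
Qed.

Lemma smooth_cst (U : set 'rV[R]_m) (b : W) : smooth_on U (fun _ : 'rV[R]_m => b).
Proof.
have -> : (fun _ : 'rV[R]_m => b) = (fun x => b + (fun=> 0) x).
  by apply/funext => x; rewrite addr0.
by apply: smooth_affine => a u v; rewrite scaler0 addr0.
Qed.

End LinearRowVectors.

(** * Chain rule in coordinates, Jacobians, continuity of determinants *)

Section Chain.
Context {R : realType} {m : nat} {V : normedModType R}.

Lemma derive_coord_sum (f : 'rV[R]_m -> R) x v : differentiable f x ->
  'D_v f x = \sum_i v 0 i * partial i f x.
Proof.
move=> df; rewrite deriveE // {1}(row_sum_delta v) linear_sum.
by apply: eq_bigr => i _; rewrite linearZ /partial deriveE.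
Qed.

Lemma derive_rV_comp (f : 'rV[R]_m -> R) (h : V -> 'rV[R]_m) x v :
  differentiable h x -> differentiable f (h x) ->
  'D_v (f \o h) x = \sum_i ('D_v h x) 0 i * partial i f (h x).
Proof.
move=> dh df; rewrite deriveE; last exact: differentiable_comp.
by rewrite diff_comp //= -deriveE // -deriveE // derive_coord_sum.
Qed.

Lemma derive_coord (h : V -> 'rV[R]_m) x v i :
  differentiable h x -> 'D_v (fun y => h y 0 i : R) x = ('D_v h x) 0 i.
Proof.
move=> dh; rewrite (derive_mx (M := h)); last exact: diff_derivable.
by rewrite mxE.
Qed.

End Chain.

(** Jacobians act on row vectors from the right, so row [i] is the derivative along the [i]-th basis
    vector. *)
Lemma jacobianE (R : realType) (m n : nat) (h : 'rV[R]_m -> 'rV[R]_n) x i j :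
  differentiable h x -> 'J h x i j = ('D_(delta_mx 0 i) h x) 0 j.
Proof. by move=> dh; rewrite deriveEjacobian // -rowE [RHS]mxE. Qed.

Lemma diff_row_mx_scalar (R : realType) (m : nat) (V : normedModType R)
    (X : V -> 'rV[R]_m) (W : V -> R) x v :
  differentiable X x -> differentiable W x ->
  'd (fun t => row_mx (X t) (W t)%:M) x v = row_mx ('D_v X x) ('D_v W x)%:M.
Proof.
move=> dX dW; pose B : 'rV[R]_(m + 1) := row_mx 0 1%:M.
(* Splitting off the last coordinate turns the map into a linear image of [X] plus [W] times a fixed
   vector. *)
have decomp (u : 'rV[R]_m) (w : R) :
    row_mx u w%:M = mulmxr (row_mx 1%:M 0) u + w *: B.
  rewrite /= mul_mx_row mulmx1 mulmx0 /B scale_row_mx scaler0 scalemx1.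
  by rewrite add_row_mx addr0 add0r.
pose L : {linear 'rV[R]_m -> 'rV[R]_(m + 1)} := mulmxr (row_mx 1%:M 0).
have -> : (fun t => row_mx (X t) (W t)%:M) = (L \o X) + (fun t => W t *: B).
  by apply/funext => t; rewrite decomp.
have dLX : differentiable (L \o X) x by exact: differentiable_linear_comp.
have dWB : differentiable (fun t => W t *: B) x by exact: differentiableZl.
rewrite -(deriveE v (differentiableD dLX dWB)).
rewrite deriveD; [|exact: diff_derivable dLX|exact: diff_derivable dWB].
by rewrite derive_linear_comp // (deriveE v dWB) diffZl // -(deriveE v dW) decomp.
Qed.

Lemma cvg_det (R : realType) (m : nat) (T : Type) (F : set_system T)
    (A : T -> 'M[R]_m) (B : 'M[R]_m) : Filter F ->
  (forall i j, A x i j @[x --> F] --> B i j) -> \det (A x) @[x --> F] --> \det B.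
Proof.
move=> FF AB; apply: cvg_big => [|s _]; first exact: add_continuous.
apply: cvgM; first exact: cvg_cst.
by apply: cvg_big => [|i _]; [exact: mul_continuous | exact: AB].
Qed.

(** * Gradient and Hessian along a graph, for a pair [X], [P] with dW = P dX *)

Section GraphGradient.
Context {R : realType} {n : nat}.
Variables (X P : 'rV[R]_n -> 'rV[R]_n) (W : 'rV[R]_n -> R) (t0 : 'rV[R]_n).
Variables (U : set 'rV[R]_n) (f : 'rV[R]_n -> R).
Hypothesis dX : \forall t \near t0, differentiable X t.
Hypothesis cX : forall v, {for t0, continuous ('D_v X)}.
Hypothesis dP : differentiable P t0.
Hypothesis dW : \forall t \near t0, forall v,
  'D_v W t = \sum_i P t 0 i * ('D_v X t) 0 i.
Hypothesis dW0 : differentiable W t0.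
Hypothesis df : twice_differentiable_on U f.
Hypothesis Wf : \forall t \near t0, U (X t) /\ W t = f (X t).
Hypothesis immersive : injective ('d (fun t => row_mx (X t) (W t)%:M) t0).

(** If [v] is killed by the Jacobian of [X], then dW(v) = P dX(v) = 0 as well, so [v] lies in the
    kernel of the differential of (X, W), which is trivial. *)
Lemma immersive_det_neq0 : \det ('J X t0) != 0.
Proof.
have dX0 := nbhs_singleton dX.
rewrite -unitfE -[_ \is a _]/('J X t0 \in unitmx) -row_free_unit -kermx_eq0.
apply/eqP/row_matrixP => i; rewrite row0; apply: immersive; rewrite linear0.
rewrite diff_row_mx_scalar //.
set v := row i _.
have Xv : 'D_v X t0 = 0.
  by rewrite deriveEjacobian // -row_mul mulmx_ker row0.
rewrite Xv (nbhs_singleton dW) Xv big1; last by move=> j _; rewrite mxE mulr0.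
by rewrite -scalemx1 scale0r row_mx0.
Qed.

Lemma jacobian_det_near : \forall t \near t0, \det ('J X t) != 0.
Proof.
have dX0 := nbhs_singleton dX.
(* [D] is built from directional derivatives, whose continuity at [t0] is given by [cX]; it agrees
   with the Jacobian determinant wherever [X] is differentiable. *)
pose D t : R := \det (\matrix_(i, j) ('D_(delta_mx 0 i) X t) 0 j : 'M[R]_n).
have cD : {for t0, continuous D}.
  apply: (cvg_det (nbhs_filter t0)) => i j; rewrite mxE; under eq_fun do rewrite mxE.
  apply: (@continuous_comp _ _ _ ('D_(delta_mx 0 i) X)
    (fun A : 'rV[R]_n => A 0 j : R)); first exact: cX.
  exact: coord_continuous.
have DE t : differentiable X t -> D t = \det ('J X t).
  by move=> dXt; congr (\det _); apply/matrixP => i j; rewrite mxE jacobianE.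
have D0 : D t0 != 0 by rewrite DE //; exact: immersive_det_neq0.
near=> t; rewrite -DE; last by near: t.
near: t; exact: (cvgr_neq0 _ cD D0).
Unshelve. all: by end_near. Qed.

(** Differentiating W = f(X) and comparing with dW = P dX shows that the Jacobian of [X] kills P -
    grad f(X); near [t0] that Jacobian is invertible. *)
Lemma gradient_near : \forall t \near t0, forall j, P t 0 j = partial j f (X t).
Proof.
(* Differentiating W = f(X) at a nearby [t] takes the identity on a whole neighbourhood of [t]. *)
have Wf2 := near_join Wf.
near=> t => j.
have dXt : differentiable X t by near: t.
have [Ut Wt] : U (X t) /\ W t = f (X t) by near: t.
have det_t : 'J X t \in unitmx.
  by rewrite unitmxE unitfE; near: t; exact: jacobian_det_near.
pose r : 'cV[R]_n := \col_j (P t 0 j - partial j f (X t)).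
suff: r = 0 by move/colP/(_ j); rewrite !mxE => /subr0_eq.
suff: 'J X t *m r = 0.
  by move/(congr1 (mulmx (invmx ('J X t)))); rewrite mulKmx // mulmx0.
apply/colP => i; rewrite [LHS]mxE [RHS]mxE.
have chain : 'D_(delta_mx 0 i) W t = 'D_(delta_mx 0 i) (f \o X) t.
  apply: near_eq_derive.
  have : \forall s \near t, U (X s) /\ W s = f (X s) by near: t.
  by apply: filterS => s [].
move: chain; rewrite (derive_rV_comp (f := f) (h := X)) //; last by have [] := df Ut.
have -> : 'D_(delta_mx 0 i) W t = \sum_k P t 0 k * ('D_(delta_mx 0 i) X t) 0 k.
  by move: (delta_mx _ _); near: t.
move/eqP; rewrite -subr_eq0 -sumrB => /eqP E; rewrite -[RHS]E.
apply: eq_bigr => k _; rewrite jacobianE // [r _ _]mxE.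
by rewrite mulrBr [P _ _ _ * _]mulrC.
Unshelve. all: by end_near. Qed.

(** The identity P = grad f(X) holds on a neighbourhood of [t0], so it may be differentiated there
    by the chain rule. *)
Lemma jacobian_gradient :
  'J P t0 = 'J X t0 *m \matrix_(i, j) partial i (partial j f) (X t0).
Proof.
have dX0 := nbhs_singleton dX.
have [Ut0 _] := nbhs_singleton Wf.
apply/matrixP => i j; rewrite jacobianE // [RHS]mxE -derive_coord //.
rewrite (near_eq_derive (g := partial j f \o X)); last first.
  by move: gradient_near; apply: filterS => t /(_ j).
rewrite (derive_rV_comp (f := partial j f) (h := X)) //; last by have [_] := df Ut0.
by apply: eq_bigr => k _; rewrite jacobianE // [X in _ = _ * X]mxE.
Qed.

Lemma det_jacobian_gradient : \det ('J P t0) = \det ('J X t0) * Hess f (X t0).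
Proof. by rewrite jacobian_gradient (det_mulmx ('J X t0)). Qed.

End GraphGradient.

(** * The contact form and the Lagrangian pair in coordinates *)

Section Coordinates.
Context {R : realType} {n : nat}.
Local Notation N := (n + 1 + n)%N.
Local Notation M := 'rV[R]_N.

Fact xcoord_linear : linear (@xcoord R n).
Proof. by move=> a u v; rewrite /xcoord !linearP. Qed.
HB.instance Definition _ := GRing.isLinear.Build R M 'rV[R]_n _
  (@xcoord R n) xcoord_linear.

Fact pcoord_linear : linear (@pcoord R n).
Proof. by move=> a u v; rewrite /pcoord !linearP. Qed.
HB.instance Definition _ := GRing.isLinear.Build R M 'rV[R]_n _
  (@pcoord R n) pcoord_linear.

Fact zcoord_linear : linear (@zcoord R n : M -> R^o).
Proof. by move=> a u v; rewrite /zcoord !linearP !mxE. Qed.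
HB.instance Definition _ := GRing.isLinear.Build R M R^o _
  (@zcoord R n) zcoord_linear.

Lemma thetaE (w v : M) : theta w v = zcoord v - \sum_i pcoord w 0 i * xcoord v 0 i.
Proof. by []. Qed.

Fact theta_linear (w : M) : linear (theta w : M -> R^o).
Proof.
move=> a u v; rewrite !thetaE (linearP (@zcoord R n : M -> R^o)) [in RHS]scalerBr.
rewrite addrACA -opprD; congr (_ - _).
rewrite scaler_sumr -big_split; apply: eq_bigr => i _ /=.
by rewrite linearP !mxE mulrDr mulrCA.
Qed.
HB.instance Definition _ (w : M) := GRing.isLinear.Build R M R^o _
  (theta w) (theta_linear w).

Definition point (x : 'rV[R]_n) (z : R) (p : 'rV[R]_n) : M := row_mx (row_mx x z%:M) p.

Lemma xcoordK x z p : xcoord (point x z p) = x.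
Proof. by rewrite /xcoord /point !row_mxKl. Qed.
Lemma zcoordK x z p : zcoord (point x z p) = z.
Proof. by rewrite /zcoord /point row_mxKl row_mxKr mxE. Qed.
Lemma pcoordK x z p : pcoord (point x z p) = p.
Proof. by rewrite /pcoord /point row_mxKr. Qed.
Definition coordK := (xcoordK, zcoordK, pcoordK).

Lemma pointK (u : M) : point (xcoord u) (zcoord u) (pcoord u) = u.
Proof.
rewrite /point (_ : (zcoord u)%:M = rsubmx (lsubmx u)) ?hsubmxK //.
by apply/matrixP => i j; rewrite !ord1 mxE mulr1n.
Qed.

Lemma coordP (u v : M) : xcoord u = xcoord v -> zcoord u = zcoord v ->
  pcoord u = pcoord v -> u = v.
Proof. by move=> ex ez ep; rewrite -(pointK u) ex ez ep pointK. Qed.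

Lemma E1_basisE (w : M) i :
  del_x i + pcoord w 0 i *: del_z = point (delta_mx 0 i) (pcoord w 0 i) 0 :> M.
Proof.
rewrite /del_x /del_z /point !scale_row_mx !add_row_mx !scaler0 !addr0 add0r.
by rewrite scalemx1.
Qed.

Lemma del_pE i : del_p i = point 0 0 (delta_mx 0 i) :> M.
Proof. by rewrite /del_p /point -scalemx1 scale0r row_mx0. Qed.

Lemma span_linear0 (V : lmodType R) k (X : k.-tuple M) (L : {linear M -> V}) u :
  (forall i, L X`_i = 0) -> u \in <<X>>%VS -> L u = 0.
Proof.
move=> LX /coord_span ->; rewrite linear_sum big1 // => i _.
by rewrite linearZZ LX scaler0.
Qed.

Lemma theta_point w x z p : theta w (point x z p) = z - \sum_i pcoord w 0 i * x 0 i.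
Proof. by rewrite thetaE !coordK. Qed.

Lemma sum_delta (a : 'rV[R]_n) i : \sum_j a 0 j * (delta_mx 0 i : 'rV[R]_n) 0 j = a 0 i.
Proof.
rewrite (bigD1 i) //= mxE !eqxx mulr1 big1 ?addr0 // => j ji.
by rewrite mxE (negPf ji) andbF mulr0.
Qed.

Lemma sum_mulr0 (a : 'rV[R]_n) : \sum_j a 0 j * (0 : 'rV[R]_n) 0 j = 0.
Proof. by apply: big1 => j _; rewrite [X in _ * X]mxE mulr0. Qed.

Lemma sum_mul0r (a : 'rV[R]_n) : \sum_j (0 : 'rV[R]_n) 0 j * a 0 j = 0.
Proof. by apply: big1 => j _; rewrite [X in X * _]mxE mul0r. Qed.

Lemma theta_E1_basis w i :
  theta w (point (delta_mx 0 i) (pcoord w 0 i) 0) = 0.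
Proof. by rewrite theta_point sum_delta subrr. Qed.

(** Replaces a span by equations. Conversely, [u] is expanded with its x-coordinates as
    coefficients; [theta w u = 0] then forces the z-coordinates to agree. *)
Lemma mem_E1 (w u : M) : u \in E1 w <-> pcoord u = 0 /\ theta w u = 0.
Proof.
split=> [uE|[pu tu]].
  (* Here [i] is a natural number; from [n] on, the entry of the tuple is the default 0. *)
  split; apply: (span_linear0 _ uE) => i; have [ik|ki] := ltnP i n.
  - by rewrite -(tnth_nth _ _ (Ordinal ik)) tnth_mktuple E1_basisE /= coordK.
  - by rewrite nth_default ?size_tuple // linear0.
  - by rewrite -(tnth_nth _ _ (Ordinal ik)) tnth_mktuple E1_basisE /= theta_E1_basis.
  - by rewrite nth_default ?size_tuple // linear0.
have -> : u = \sum_i xcoord u 0 i *: (del_x i + pcoord w 0 i *: del_z).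
  apply: coordP; rewrite linear_sum.
  - rewrite {1}[xcoord u]row_sum_delta; apply: eq_bigr => i _.
    by rewrite linearZZ E1_basisE /= coordK.
  - move/eqP: tu; rewrite thetaE subr_eq0 => /eqP ->; apply: eq_bigr => i _.
    by rewrite linearZZ E1_basisE /= coordK mulrC.
  - by rewrite pu big1 // => i _; rewrite linearZZ E1_basisE /= coordK scaler0.
apply: memv_suml => i _; apply: memvZ; apply: memv_span.
by apply/tnthP; exists i; rewrite tnth_mktuple.
Qed.

Lemma mem_E2 (w u : M) : u \in E2 w <-> xcoord u = 0 /\ zcoord u = 0.
Proof.
split=> [uE|[xu zu]].
  split; apply: (span_linear0 _ uE) => i; have [ik|ki] := ltnP i n.
  - by rewrite -(tnth_nth _ _ (Ordinal ik)) tnth_mktuple del_pE /= coordK.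
  - by rewrite nth_default ?size_tuple // linear0.
  - by rewrite -(tnth_nth _ _ (Ordinal ik)) tnth_mktuple del_pE /= coordK.
  - by rewrite nth_default ?size_tuple // linear0.
have -> : u = \sum_i pcoord u 0 i *: del_p i.
  apply: coordP; rewrite linear_sum.
  - by rewrite xu big1 // => i _; rewrite linearZZ del_pE /= coordK scaler0.
  - by rewrite zu big1 // => i _; rewrite linearZZ del_pE /= coordK scaler0.
  - rewrite {1}[pcoord u]row_sum_delta; apply: eq_bigr => i _.
    by rewrite linearZZ del_pE /= coordK.
apply: memv_suml => i _; apply: memvZ; apply: memv_span.
by apply/tnthP; exists i; rewrite tnth_mktuple.
Qed.

Lemma mem_contact (w u : M) : u \in contact_distribution theta w <-> theta w u = 0.
Proof. by rewrite memv_ker lfunE; split => /eqP. Qed.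

(** This is the linear part of [theta y v] as an affine function of the base point [y], the constant
    part being [zcoord v]; the derivative and the smoothness of [theta] follow from it. *)
Lemma contraction_linear (v : M) :
  linear (fun y : M => - \sum_i pcoord y 0 i * xcoord v 0 i : R^o).
Proof.
move=> a y y'; rewrite scalerN scaler_sumr -opprD -big_split; congr (- _).
by apply: eq_bigr => i _ /=; rewrite linearP !mxE mulrDl -mulrA.
Qed.

Lemma derive_theta (w u v : M) :
  'D_u (fun y => theta y v) w = - \sum_i pcoord u 0 i * xcoord v 0 i.
Proof. exact: (derive_affine (zcoord v : R^o) w u (contraction_linear v)).2. Qed.

(** This is the standard form, the sum of the dx_i /\ dp_i. Once the rows of the two-row matrix are
    identified, it is the difference of two derivatives of [theta]. *)
Lemma ext_d_theta (w u v : M) :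
  ext_d theta w (col_mx u v) =
    \sum_i pcoord v 0 i * xcoord u 0 i - \sum_i pcoord u 0 i * xcoord v 0 i.
Proof.
have upper (a b : M) i0 : i0 = lshift 1 ord0 -> row i0 (col_mx a b) = a.
  by move=> ->; apply/rowP => j; rewrite mxE col_mxEu.
have lower (a b : M) i0 : i0 = rshift 1 ord0 -> row i0 (col_mx a b) = b.
  by move=> ->; apply/rowP => j; rewrite mxE col_mxEd.
have r0 (a b : M) : row' ord0 (col_mx a b) = b.
  rewrite -[RHS](lower a b (lift ord0 ord0)); last by apply: val_inj.
  by apply/rowP => j; rewrite !mxE.
have r1 (a b : M) : row' (lift ord0 ord0) (col_mx a b) = a.
  rewrite -[RHS](upper a b ord0); last by apply: val_inj.
  apply/rowP => j; rewrite [LHS]mxE [RHS]mxE; congr (col_mx a b _ j).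
  by apply: val_inj.
have s0 (a b : M) : row ord0 (col_mx a b) = a by apply: upper; by apply: val_inj.
have s1 (a b : M) : row (lift ord0 ord0) (col_mx a b) = b.
  by apply: lower; by apply: val_inj.
rewrite /ext_d !big_ord_recl big_ord0 addr0 r0 r1 s0 s1 !derive_theta.
by rewrite expr0 mul1r expr1 mulN1r opprK addrC.
Qed.

Lemma theta_diff_form : diff_form setT (@theta R n).
Proof.
split=> [x _ A B C i b c e _ _|x _ A i j|v].
- have rowE1 (D : M) : row i D = D by apply/rowP => j; rewrite mxE ord1.
  by move: e; rewrite !rowE1 => ->; rewrite linearD !linearZZ.
- by rewrite !ord1.
- exact: (smooth_affine (zcoord v : R^o) (contraction_linear v)).
Qed.

(** Nondegeneracy on the contact distribution: pairing [u] with the [del_p i] kills its x-part,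
    [theta x u = 0] then kills its z-part, and pairing with the basis of [E1] kills its p-part. *)
Lemma theta_contact_form : contact_form (@theta R n).
Proof.
split; first exact: theta_diff_form.
  (* The vector d/dz, on which [theta] takes the value 1. *)
  by move=> x; exists (point 0 1 0); rewrite theta_point sum_mulr0 subr0 oner_neq0.
move=> x u /mem_contact tu du.
have xu : xcoord u = 0.
  apply/rowP => i; rewrite [RHS]mxE; have := du (point 0 0 (delta_mx 0 i)).
  rewrite ext_d_theta !coordK sum_mulr0 subr0.
  under eq_bigr do rewrite mulrC.
  by rewrite sum_delta; apply; apply/mem_contact; rewrite theta_point sum_mulr0 subr0.
apply: coordP; rewrite ?linear0 //.
  by move: tu; rewrite thetaE xu sum_mulr0 subr0.
apply/rowP => i; rewrite [RHS]mxE.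
have := du (point (delta_mx 0 i) (pcoord x 0 i) 0).
rewrite ext_d_theta !coordK sum_mul0r sum_delta sub0r => H.
apply/eqP; rewrite -oppr_eq0; apply/eqP/H.
by apply/mem_contact; rewrite theta_E1_basis.
Qed.

Lemma E1_subbundle : subbundle n (@E1 R n).
Proof.
move=> x0; exists setT, (fun i w => del_x i + pcoord w 0 i *: del_z); split=> //.
- exact: openT.
- move=> i; apply: smooth_affine => a u v.
  by rewrite linearP !mxE scalerDl scalerA.
- move=> w _; rewrite /basis_of eqxx; apply/freeP => k k0 i.
  move/(congr1 (@xcoord R n)): k0; rewrite linear_sum linear0 => /rowP/(_ i).
  rewrite summxE [RHS]mxE => <-.
  transitivity ((\row_j k j) 0 i); [by rewrite mxE | rewrite -sum_delta].
  apply: eq_bigr => j _; rewrite -tnth_nth tnth_mktuple linearZZ.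
  rewrite E1_basisE /= coordK !mxE.
  by rewrite eq_sym.
Qed.

Lemma E2_subbundle : subbundle n (@E2 R n).
Proof.
move=> x0; exists setT, (fun i _ => del_p i); split=> //.
- exact: openT.
- by move=> i; exact: smooth_cst.
- move=> w _; rewrite /basis_of eqxx; apply/freeP => k k0 i.
  move/(congr1 (@pcoord R n)): k0; rewrite linear_sum linear0 => /rowP/(_ i).
  rewrite summxE [RHS]mxE => <-.
  transitivity ((\row_j k j) 0 i); [by rewrite mxE | rewrite -sum_delta].
  apply: eq_bigr => j _; rewrite -tnth_nth tnth_mktuple linearZZ.
  rewrite del_pE /= coordK !mxE.
  by rewrite eq_sym.
Qed.

(** Each term of d theta pairs an x-coordinate with a p-coordinate, so d theta vanishes where all
    p-parts vanish ([E1]) and where all x-parts vanish ([E2]). *)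
Lemma theta_lagrangian_pair : lagrangian_pair (@theta R n) E1 E2.
Proof.
split; [exact: theta_contact_form | | |].
- by split; [exact: E1_subbundle | exact: E2_subbundle].
- split=> x u v.
    move=> /mem_E1[pu _] /mem_E1[pv _].
    by rewrite ext_d_theta pu pv !sum_mul0r subrr.
  move=> /mem_E2[xu _] /mem_E2[xv _].
  by rewrite ext_d_theta xu xv !sum_mulr0 subrr.
- move=> w; split.
    apply/directv_addP/eqP; rewrite -subv0; apply/subvP => u.
    rewrite memv_cap memv0 => /andP[/mem_E1[pu _] /mem_E2[xu zu]].
    by apply/eqP/coordP; rewrite ?pu ?xu ?zu linear0.
  apply/vspaceP => u; apply/idP/idP.
    move=> /mem_contact tu; apply/memv_addP.
    (* [theta] ignores the p-part of a tangent vector, so dropping it stays in the contact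
       distribution and lands in [E1]. *)
    exists (point (xcoord u) (zcoord u) 0).
      by apply/mem_E1; rewrite coordK theta_point; split=> //; exact: tu.
    exists (point 0 0 (pcoord u)); first by apply/mem_E2; rewrite !coordK.
    by apply: coordP; rewrite linearD /= !coordK ?addr0 ?add0r.
  move=> /memv_addP[a /mem_E1[_ ta] [b /mem_E2[xb zb] ->]].
  by apply/mem_contact; rewrite linearD /= ta add0r thetaE xb zb sum_mulr0 subrr.
Qed.

End Coordinates.

(** * Constant forms given by maximal minors *)

Section MinorForms.
Context {R : realType} {N : nat}.

Lemma constant_diff_form (U : set 'rV[R]_N) k (a : 'M[R]_(k, N) -> R) :
  multilinear_rows a -> alternating_rows a -> diff_form U (fun _ => a).
Proof. by move=> ma aa; split=> [x _|x _|v] //; exact: smooth_cst. Qed.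

Lemma colsub_det_multilinear k (g : 'I_k -> 'I_N) (a : R) :
  multilinear_rows (fun v : 'M[R]_(k, N) => a * \det (colsub g v)).
Proof.
move=> A B C i b c e eB eC.
rewrite (@determinant_multilinear _ _ _ (colsub g B) (colsub g C) i b c).
- by rewrite mulrDr !(mulrCA a).
- apply/rowP => j; move/rowP: e => /(_ (g j)); rewrite !mxE.
  by [].
- by apply/matrixP => r j; move/matrixP: eB => /(_ r (g j)); rewrite !mxE.
- by apply/matrixP => r j; move/matrixP: eC => /(_ r (g j)); rewrite !mxE.
Qed.

Lemma colsub_det_alternating k (g : 'I_k -> 'I_N) (a : R) :
  alternating_rows (fun v : 'M[R]_(k, N) => a * \det (colsub g v)).
Proof.
move=> A i j ij e; rewrite (determinant_alternate ij) ?mulr0 // => l.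
by move/rowP: e => /(_ (g l)); rewrite !mxE.
Qed.

(** Contraction puts [u] in the top row; the entries of [u] in the selected columns vanish, so
    expansion along that row gives 0. In degree 0 the interior product is 0 by definition. *)
Lemma interior_colsub_det k (g : 'I_k -> 'I_N) (a : R) (u : 'rV[R]_N) :
  (forall j, u 0 (g j) = 0) ->
  Defs.interior u (fun v : 'M[R]_(k, N) => a * \det (colsub g v)) = fun=> 0.
Proof.
case: k g => [//|k] g ug; apply/funext => v /=.
rewrite (expand_det_row _ ord0) big1 ?mulr0 // => j _.
have -> : colsub g (col_mx u v : 'M[R]_(k.+1, N)) ord0 j = u 0 (g j).
  rewrite mxE -[RHS](col_mxEu u v); congr (col_mx u v _ _); exact: val_inj.
by rewrite ug mul0r.
Qed.

End MinorForms.

(** * Bi-decomposability of omega *)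

Section MongeAmpere.
Context {R : realType} {n : nat}.
Local Notation N := (n + 1 + n)%N.
Local Notation M := 'rV[R]_N.

Definition xindex (j : 'I_n) : 'I_N := lshift n (lshift 1 j).
Definition pindex (j : 'I_n) : 'I_N := rshift (n + 1) j.

(** The factor [1] gives both terms the shape of the lemmas on minors. *)
Lemma omegaE c (w : M) v :
  omega c w v = c * \det (colsub xindex v) - 1 * \det (colsub pindex v).
Proof.
rewrite /omega !wedge_family_det mul1r.
congr (_ - _); [congr (c * _)|];
  by congr (determinant _); apply/matrixP => i j;
    rewrite !mxE /dx /dp /xcoord /pcoord !mxE.
Qed.

Lemma omega_diff_form c : diff_form setT (@omega R n c).
Proof.
have -> : omega c = fun=> fun v =>
    c * \det (colsub xindex v) - 1 * \det (colsub pindex v).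
  by apply/funext => w; apply/funext => v; exact: omegaE.
apply: constant_diff_form => [A B C i b d e eB eC|A i j ij e].
  rewrite (colsub_det_multilinear xindex c e eB eC).
  rewrite (colsub_det_multilinear pindex 1 e eB eC).
  by rewrite opprD addrACA !mulrBr.
by rewrite !(colsub_det_alternating _ _ ij e) subrr.
Qed.

Lemma omega_bidecomposable c : c != 0 -> bidecomposable (@E1 R n) E2 (omega c).
Proof.
(* The decomposition is global: omega1 is [c] times the minor on the x-columns, omega2 the minor on
   the p-columns. *)
move=> c0 w0; exists setT, (fun _ v => c * \det (colsub xindex v)),
  (fun _ v => 1 * \det (colsub pindex v)); split.
- by split=> //; exact: openT.
- by split; apply: constant_diff_form;
    [exact: colsub_det_multilinear | exact: colsub_det_alternating
    |exact: colsub_det_multilinear | exact: colsub_det_alternating].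
- by move=> w _; apply/funext => v; exact: omegaE.
- move=> w _; split=> u.
    move=> /mem_E2[/rowP xu _]; apply: interior_colsub_det => j.
    by have := xu j; rewrite !mxE.
  move=> /mem_E1[/rowP pu _]; apply: interior_colsub_det => j.
  by have := pu j; rewrite !mxE.
- move=> w _; split.
    (* The rows are the basis of [E1]; its x-columns form the identity, so omega1 takes the value
       [c], nonzero by [c0]. *)
    exists (row_mx (row_mx 1%:M (pcoord w)^T) 0); split=> [i|].
      have -> : row i (row_mx (row_mx 1%:M (pcoord w)^T) 0) =
          point (delta_mx 0 i) (pcoord w 0 i) 0.
        rewrite !row_row_mx row0 row1; congr (row_mx (row_mx _ _) _).
        by apply/matrixP => j k; rewrite !ord1 !mxE mulr1n.
      by apply/mem_E1; rewrite coordK theta_E1_basis.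
    rewrite (_ : colsub _ _ = 1%:M) ?det1 ?mulr1 //.
    by apply/matrixP => i j; rewrite mxE /xindex !row_mxEl.
  exists (row_mx 0 1%:M); split=> [i|].
    by rewrite row_row_mx row0 row1 -/(del_p i) del_pE; apply/mem_E2; rewrite !coordK.
  rewrite (_ : colsub _ _ = 1%:M) ?det1 ?mulr1 ?oner_neq0 //.
  by apply/matrixP => i j; rewrite mxE /pindex row_mxEr.
Qed.

Lemma generated_monge_ampere_system c : c != 0 ->
  monge_ampere_system (@theta R n) E1 E2 (generated_ideal theta (omega c)).
Proof.
move=> c0; split; first exact: theta_lagrangian_pair.
by exists (omega c); split=> //;
  [exact: omega_diff_form | exact: omega_bidecomposable].
Qed.

End MongeAmpere.

(** * Leibniz rule for the dot product, used for the Legendre transform *)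

Lemma differentiable_dot (R : realType) (m : nat) (V : normedModType R)
    (X P : V -> 'rV[R]_m) x : differentiable X x -> differentiable P x ->
  differentiable (fun t => \sum_i P t 0 i * X t 0 i) x.
Proof.
move=> dX dP.
have -> : (fun t => \sum_i P t 0 i * X t 0 i) = \sum_i (fun t => P t 0 i * X t 0 i).
  by apply/funext => t; rewrite fct_sumE.
apply: differentiable_sum => i; apply: differentiableM;
  by apply: (differentiable_comp (g := fun A : 'rV[R]_m => A 0 i : R)) => //;
    exact: differentiable_coord.
Qed.

Lemma derive_dot (R : realType) (m : nat) (V : normedModType R)
    (X P : V -> 'rV[R]_m) x v : differentiable X x -> differentiable P x ->
  'D_v (fun t => \sum_i P t 0 i * X t 0 i) x =
  \sum_i P x 0 i * ('D_v X x) 0 i + \sum_i X x 0 i * ('D_v P x) 0 i.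
Proof.
move=> dX dP.
have dc (Y : V -> 'rV[R]_m) i :
    differentiable Y x -> derivable (fun t => Y t 0 i : R) x v.
  move=> dY; apply: diff_derivable.
  by apply: (differentiable_comp (g := fun A : 'rV[R]_m => A 0 i : R)) => //;
    exact: differentiable_coord.
have -> : (fun t => \sum_i P t 0 i * X t 0 i) = \sum_i (fun t => P t 0 i * X t 0 i).
  by apply/funext => t; rewrite fct_sumE.
rewrite derive_sum => [|i]; last by apply: derivableM; exact: dc.
rewrite -big_split; apply: eq_bigr => i _ /=.
by rewrite deriveM ?derive_coord //; exact: dc.
Qed.

(** * The Hessian equations along a geometric solution *)

Section HessEquation.
Context {R : realType} {n : nat} {L : topologicalType}.
Variable A : set (chart R n L).
Hypothesis mA : smooth_manifold A.

(** Reduces the equation to one chart around a nonsingular point: there the differential is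
    injective, and the graph relation holds for all nearby chart parameters. *)
Lemma satisfies_Hess_eq_charts (h : L -> 'rV[R]_(n + 1)) (a : R) :
  (forall ch t0 (U : set 'rV[R]_n) (f : 'rV[R]_n -> R),
     A ch -> chart_im ch t0 -> twice_differentiable_on U f ->
     (\forall t \near t0, U (lsubmx (h (chart_inv ch t))) /\
        rsubmx (h (chart_inv ch t)) 0 0 = f (lsubmx (h (chart_inv ch t)))) ->
     injective ('d (h \o chart_inv ch) t0) ->
     Hess f (lsubmx (h (chart_inv ch t0))) = a) ->
  satisfies_Hess_eq A h a.
Proof.
move=> H O U f oO oU df hO q Oq /contrapT imm.
have [_ chA cov _] := mA; have [ch Ach chq] := cov q.
have [_ invK _ cinv] := chA _ Ach.
have imq : chart_im ch (chart_map ch q) by exists q.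
rewrite -(invK _ chq); apply: (H _ _ U) => //; last exact: imm.
(* Continuity of the inverse chart pulls the open set [O] back to a neighbourhood in R^n. *)
have Onear : \forall t \near chart_map ch q, O (chart_inv ch t).
  apply: (cinv _ imq); rewrite invK //; exact: open_nbhs_nbhs.
near=> t; have : (h @` O) (h (chart_inv ch t)) by exists (chart_inv ch t) => //; near: t.
rewrite hO => -[x Ux <-]; rewrite row_mxKl row_mxKr; split=> //.
by rewrite mxE mulr1n.
Unshelve. all: by end_near. Qed.

Variables (c : R) (g : L -> 'rV[R]_(n + 1 + n)).
Hypothesis sol : geometric_solution A theta (omega c) g.

Section InChart.
Variables (ch : chart R n L) (t0 : 'rV[R]_n).
Hypotheses (Ach : A ch) (imt0 : chart_im ch t0).
Let phi := g \o chart_inv ch.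
Let X := @xcoord R n \o phi.
Let P := @pcoord R n \o phi.
Let Z := @zcoord R n \o phi.

Lemma chart_im_near : \forall t \near t0, chart_im ch t.
Proof.
have [_ chA _ _] := mA; have [[_ oim] _ _ _] := chA _ Ach.
exact: open_nbhs_nbhs.
Qed.

Lemma solution_differentiable t : chart_im ch t -> differentiable phi t.
Proof. by move=> imt; have [[+ _] _ _] := sol; move/(_ _ Ach [::] t imt). Qed.

(** Smoothness applied to the one-element list [[:: v]] makes ['D_v phi] differentiable, hence
    continuous. *)
Lemma solution_derive_continuous v : {for t0, continuous ('D_v phi)}.
Proof.
apply: differentiable_continuous.
by have [[+ _] _ _] := sol; move/(_ _ Ach [:: v] t0 imt0).
Qed.

Lemma solution_linear_derivative (W : normedModType R)
    (K : {linear 'rV[R]_(n + 1 + n) -> W}) t v : chart_im ch t ->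
  differentiable (K \o phi) t /\ 'D_v (K \o phi) t = K ('D_v phi t).
Proof.
move=> /solution_differentiable d; split; first exact: differentiable_linear_comp.
exact: derive_linear_comp.
Qed.

Lemma solution_linear_derive_continuous (W : normedModType R)
    (K : {linear 'rV[R]_(n + 1 + n) -> W}) v :
  {for t0, continuous ('D_v (K \o phi))}.
Proof.
(* The derivative commutes with [K] on the chart image, a neighbourhood of [t0]; this is enough to
   transfer the limit. *)
have E : \forall t \near t0, K ('D_v phi t) = 'D_v (K \o phi) t.
  move: chart_im_near; apply: filterS => t imt.
  by rewrite (solution_linear_derivative K v imt).2.
have c0 : K ('D_v phi t) @[t --> t0] --> 'D_v (K \o phi) t0.
  rewrite -(nbhs_singleton E).
  apply: (@continuous_comp _ _ _ ('D_v phi) K).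
    exact: solution_derive_continuous.
  exact/differentiable_continuous/linear_rV_differentiable.
exact: cvg_trans (near_eq_cvg E) c0.
Qed.

Let x_derivative t v : chart_im ch t ->
  differentiable X t /\ 'D_v X t = xcoord ('D_v phi t).
Proof. exact: (solution_linear_derivative (@xcoord R n)). Qed.

Let p_derivative t v : chart_im ch t ->
  differentiable P t /\ 'D_v P t = pcoord ('D_v phi t).
Proof. exact: (solution_linear_derivative (@pcoord R n)). Qed.

(** This is the vanishing of the pullback of [theta], read on the vector [v]. *)
Lemma z_derivative t v : chart_im ch t ->
  differentiable Z t /\ 'D_v Z t = \sum_i P t 0 i * ('D_v X t) 0 i.
Proof.
move=> imt; have d := solution_differentiable imt.
have [dZ ->] :=
  @solution_linear_derivative R^o (@zcoord R n) t v imt.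
split=> //; have [_ ->] := x_derivative v imt.
have [_ th _] := sol; have := congr1 (fun w => w v) (th _ Ach t imt).
rewrite /pullback -deriveEjacobian // thetaE => /eqP.
by rewrite subr_eq0 => /eqP.
Qed.

Lemma jacobian_det_eq : c * \det ('J X t0) = \det ('J P t0).
Proof.
have d := solution_differentiable imt0.
(* The identity matrix is the tuple of coordinate vectors of the chart, so the pulled-back minors
   are the Jacobian determinants of [X] and [P]. *)
have [_ _ om] := sol; have := congr1 (fun w => w 1%:M) (om _ Ach t0 imt0).
rewrite /pullback mul1mx omegaE mul1r => /eqP; rewrite subr_eq0 => /eqP.
have -> : colsub xindex ('J phi t0) = 'J X t0.
  apply/matrixP => i j; rewrite [LHS]mxE !jacobianE //.
    by rewrite (x_derivative _ imt0).2 !mxE.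
  exact: (x_derivative 0 imt0).1.
have -> // : colsub pindex ('J phi t0) = 'J P t0.
apply/matrixP => i j; rewrite [LHS]mxE !jacobianE //.
  by rewrite (p_derivative _ imt0).2 !mxE.
exact: (p_derivative 0 imt0).1.
Qed.

Variables (U : set 'rV[R]_n) (f : 'rV[R]_n -> R).
Hypothesis df : twice_differentiable_on U f.

Lemma Hess_pi1 :
  (\forall t \near t0, U (X t) /\ Z t = f (X t)) ->
  injective ('d (fun t => row_mx (X t) (Z t)%:M) t0) -> Hess f (X t0) = c.
Proof.
move=> Zf imm.
have dX : \forall t \near t0, differentiable X t.
  by move: chart_im_near; apply: filterS => t /(x_derivative 0)[].
have dP : differentiable P t0 by have [] := p_derivative 0 imt0.
have dZ0 : differentiable Z t0 by have [] := z_derivative 0 imt0.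
have dZ : \forall t \near t0, forall v,
    'D_v Z t = \sum_i P t 0 i * ('D_v X t) 0 i.
  by move: chart_im_near; apply: filterS => t imt v; have [] := z_derivative v imt.
have det0 := immersive_det_neq0 dX dZ dZ0 imm.
have cX v : {for t0, continuous ('D_v X)}.
  exact: (@solution_linear_derive_continuous _ (@xcoord R n)).
have e := det_jacobian_gradient dX cX dP dZ dZ0 df Zf imm.
(* With d = det(dX) and d' = det(dP), the nonzero [d] is cancelled. *)
have solve (d d' H : R) : d != 0 -> d' = d * H -> c * d = d' -> H = c.
  by move=> d0 ->; rewrite mulrC => /(mulfI d0).
exact: solve det0 e jacobian_det_eq.
Qed.

Hypothesis c_neq0 : c != 0.

Lemma Hess_pi2 :
  let W t := \sum_i P t 0 i * X t 0 i - Z t in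
  (\forall t \near t0, U (P t) /\ W t = f (P t)) ->
  injective ('d (fun t => row_mx (P t) (W t)%:M) t0) -> Hess f (P t0) = 1 / c.
Proof.
move=> W Wf imm.
have dP : \forall t \near t0, differentiable P t.
  by move: chart_im_near; apply: filterS => t /(p_derivative 0)[].
have dX : differentiable X t0 by have [] := x_derivative 0 imt0.
have dW t v : chart_im ch t -> differentiable W t /\
    'D_v W t = \sum_i X t 0 i * ('D_v P t) 0 i.
  move=> imt; have [dXt _] := x_derivative v imt; have [dPt _] := p_derivative v imt.
  have [dZt DZ] := z_derivative v imt; have dD := differentiable_dot dXt dPt.
  split; first exact: differentiableB.
  rewrite deriveB; [|exact: diff_derivable dD|exact: diff_derivable dZt].
  (* The term P dX of the product rule cancels against dZ. *)
  by rewrite derive_dot // DZ addrAC subrr add0r.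
have dW0 : differentiable W t0 by have [] := dW t0 0 imt0.
have dW1 : \forall t \near t0, forall v,
    'D_v W t = \sum_i X t 0 i * ('D_v P t) 0 i.
  by move: chart_im_near; apply: filterS => t imt v; have [] := dW t v imt.
have det0 := immersive_det_neq0 dP dW1 dW0 imm.
have cP v : {for t0, continuous ('D_v P)}.
  exact: (@solution_linear_derive_continuous _ (@pcoord R n)).
(* The graph lemmas apply with [X] and [P] exchanged and [W] in place of [Z]. *)
have e := det_jacobian_gradient dP cP dX dW1 dW0 df Wf imm.
(* Now d = det(dP) and d' = det(dX); cancelling [d] leaves c H = 1. *)
have solve d d' H : d != 0 -> d' = d * H -> c * d' = d -> H = 1 / c.
  move=> d0 ->; rewrite mulrCA -[RHS]mulr1 => /(mulfI d0) cH.
  by apply: (mulfI c_neq0); rewrite cH mul1r divff.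
exact: solve det0 e jacobian_det_eq.
Qed.

End InChart.
End HessEquation.

Theorem proposition8p1 (R : realType) (n : nat) (c : R) (hc : c != 0) :
  monge_ampere_system (@theta R n) E1 E2 (generated_ideal theta (omega c)) /\
  (forall (L : topologicalType) (A : set (chart R n L))
          (g : L -> 'rV[R]_(n + 1 + n)),
     smooth_manifold A -> geometric_solution A theta (omega c) g ->
     satisfies_Hess_eq A (pi1 \o g) c /\
     satisfies_Hess_eq A (pi2 \o g) (1 / c)).
Proof.
split; first exact: generated_monge_ampere_system.
move=> L A g mA sol.
have entry (x : 'rV[R]_n) (z : R) : rsubmx (row_mx x z%:M) 0 0 = z.
  by rewrite row_mxKr mxE mulr1n.
split; apply: (satisfies_Hess_eq_charts mA) => ch t0 U f Ach imt0 df near_f imm.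
  rewrite row_mxKl; apply: (Hess_pi1 mA sol Ach imt0 df _ imm).
  by move: near_f; apply: filterS => t; rewrite row_mxKl entry.
rewrite row_mxKl; apply: (Hess_pi2 mA sol Ach imt0 df hc _ imm).
by move: near_f; apply: filterS => t; rewrite row_mxKl entry.
Qed.
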